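(* Let $X$ be a compact metric space, $T:X\to X$ continuous with finite topological entropy $h_{top}(T)<\infty$, and $f:X\to\mathbb R$ continuous. If $Z\subseteq X$ is analytic, then \[ P_B(T,f,Z)=\sup\{P_B(T,f,K):\ K\subseteq Z,\ K \text{ compact}\}. \]
   Context: A subset of a metric space is analytic if it is a continuous image of $\mathcal N=\mathbb N^{\mathbb N}$ with the product topology. Notation: $d$ is the metric on $X$; $d_n(x,y)=\max\{d(T^ix,T^iy):0\le i\le n-1\}$, $B_n(x,\epsilon)=\{y:d_n(x,y)<\epsilon\}$, $f_n=\sum_{i=0}^{n-1}f\circ T^i$. Bowen topological pressure of $Z\subseteq X$: for $\epsilon>0$, $\Gamma=\{B_{n_i}(x_i,\epsilon)\}_i$ (finite or countable) is a cover of $Z$ if $Z\subseteq\bigcup_iB_{n_i}(x_i,\epsilon)$; $n(\Gamma)=\min_in_i$. For $s\in\mathbb R$, $N\in\mathbb N$, $M(Z,f,s,N,\epsilon)=\inf_\Gamma\sum_i\exp\big(-sn_i+\sup_{y\in B_{n_i}(x_i,\epsilon)}f_{n_i}(y)\big)$ over covers with $n(\Gamma)\ge N$; $m(Z,f,s,\epsilon)=\lim_{N\to\infty}M(Z,f,s,N,\epsilon)$; $P_B(T,f,Z,\epsilon)=\inf\{s:m(Z,f,s,\epsilon)=0\}=\sup\{s:m(Z,f,s,\epsilon)=+\infty\}$; $P_B(T,f,Z)=\lim_{\epsilon\to0}P_B(T,f,Z,\epsilon)$. *)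

(* Defs.v *)
From HB Require Import structures.
From mathcomp Require Import all_boot all_order all_algebra.
From mathcomp Require Import all_classical all_reals all_analysis.
Set Implicit Arguments. Unset Strict Implicit. Unset Printing Implicit Defensive.
Import Order.TTheory GRing.Theory Num.Theory.
Import numFieldNormedType.Exports.
Local Open Scope classical_set_scope.
Local Open Scope ring_scope.

Section Defs.
Variables (R : realType) (X : Type).

Definition is_metric (d : X -> X -> R) : Prop :=
  [/\ (forall x y, 0 <= d x y),
      (forall x y, d x y = 0 <-> x = y),
      (forall x y, d x y = d y x) &
      (forall x y z, d x z <= d x y + d y z)].

Definition dball (d : X -> X -> R) (x : X) (r : R) : set X := [set y | d x y < r].

Definition d_open (d : X -> X -> R) (U : set X) : Prop :=
  forall x, U x -> exists2 r : R, 0 < r & dball d x r `<=` U.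

Definition d_compact (d : X -> X -> R) (K : set X) : Prop :=
  forall F : set (set X), (forall U, F U -> d_open d U) ->
    (K `<=` \bigcup_(U in F) U) ->
    exists s : seq (set X), (forall U, U \in s -> F U) /\
      K `<=` (fun x => exists2 U, U \in s & U x).

Definition d_continuous_self (d : X -> X -> R) (T : X -> X) : Prop :=
  forall x (e : R), 0 < e -> exists2 dl : R, 0 < dl &
    forall y, d x y < dl -> d (T x) (T y) < e.

Definition d_continuous_real (d : X -> X -> R) (f : X -> R) : Prop :=
  forall x (e : R), 0 < e -> exists2 dl : R, 0 < dl &
    forall y, d x y < dl -> `|f x - f y| < e.

(** analytic: continuous image of the Baire space N^N (product topology) *)
Definition analytic (d : X -> X -> R) (Z : set X) : Prop :=
  exists g : (nat -> nat) -> X,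
    (forall (a : nat -> nat) (e : R), 0 < e -> exists k : nat,
        forall b : nat -> nat, (forall i, (i < k)%N -> b i = a i) ->
          d (g a) (g b) < e)
    /\ range g = Z.

Variables (d : X -> X -> R) (T : X -> X).

Definition dn (n : nat) (x y : X) : R :=
  \big[Num.max/0]_(i < n) d (iter i T x) (iter i T y).

Definition Bn (n : nat) (x : X) (e : R) : set X := [set y | dn n x y < e].

Definition fsum (f : X -> R) (n : nat) (y : X) : R :=
  \sum_(i < n) f (iter i T y).

Definition separated (n : nat) (e : R) (k : nat) (E : 'I_k -> X) : Prop :=
  forall i j : 'I_k, i <> j -> e < dn n (E i) (E j).

(* maximal cardinality of an (n,e)-separated set (points listed injectively) *)
Definition sep_card (n : nat) (e : R) : \bar R :=
  ereal_sup [set (k%:R)%:E | k in [set k : nat | exists E : 'I_k -> X, separated n e E]].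

Definition htop_eps (e : R) : \bar R :=
  limn_esup (fun n : nat => ((n%:R)^-1)%:E * lne (sep_card n e))%E.

Definition htop : \bar R := lim (htop_eps e @[e --> 0^'+]).

Variable f : X -> R.

(* a (finite or countable) family of Bowen balls, indexed by I ⊆ nat,
   with centres xs and lengths ns, covering Z, with n(Gamma) >= N *)
Definition bowen_cover (Z : set X) (N : nat) (e : R)
    (I : set nat) (xs : nat -> X) (ns : nat -> nat) : Prop :=
  (forall i, I i -> (N <= ns i)%N) /\
  Z `<=` \bigcup_(i in I) Bn (ns i) (xs i) e.

Definition cover_weight (s : R) (e : R) (xs : nat -> X) (ns : nat -> nat)
    (i : nat) : \bar R :=
  expeR ((- s * (ns i)%:R)%:E +
         ereal_sup [set (fsum f (ns i) y)%:E | y in Bn (ns i) (xs i) e])%E.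

Definition MB (Z : set X) (s : R) (N : nat) (e : R) : \bar R :=
  ereal_inf [set v : \bar R | exists (I : set nat) (xs : nat -> X) (ns : nat -> nat),
               bowen_cover Z N e I xs ns /\
               v = (\esum_(i in I) cover_weight s e xs ns i)%E].

Definition mB (Z : set X) (s : R) (e : R) : \bar R :=
  limn (fun N : nat => MB Z s N e).

Definition PB_eps (Z : set X) (e : R) : \bar R :=
  ereal_inf [set s%:E | s in [set s : R | mB Z s e = 0%E]].

Definition PB (Z : set X) : \bar R := lim (PB_eps Z e @[e --> 0^'+]).

End Defs.

(* Main.v *)
Require Import Defs.
From HB Require Import structures.
From mathcomp Require Import all_boot all_order all_algebra.
From mathcomp Require Import all_classical all_reals all_analysis.
From mathcomp Require Import ring lra.
Import Order.TTheory GRing.Theory Num.Theory.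
Import numFieldNormedType.Exports.
Local Open Scope classical_set_scope.
Local Open Scope ring_scope.
Set Implicit Arguments.
Unset Strict Implicit.
Unset Printing Implicit Defensive.

(* The difficulty is to find, for Bowen balls, an outer measure that is
   continuous along increasing sets, so that capacitability applies.  Cylinder
   sets of a symbolic coding are nested or disjoint, hence such a measure (a net
   measure) exists for them; what has to be shown is that coding costs little
   pressure.  Fix e > 0, a finite e/4-net c_1 .. c_p, and code orbit segments of
   length k by the spheres of radius r around the c_j, e/4 <= r < e/2.  If more
   than pk radii are allowed, every point x has one whose spheres stay away from
   x, T x, .., T^(k-1) x.  Label x by such a radius and the resulting itinerary:
   equal labels force d_k < e, while a small Bowen ball of length k meets at
   most pk + 1 labels.  Hence a ball of length n meets about (pk + 1)^(n/k)
   cylinders, a growth rate log(pk + 1)/k that vanishes as k grows.  A box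
   {a <= b} of the Baire space is then chosen so that all its truncations keep
   positive cylinder content; an open cover of its compact image K covers the
   image of a truncation, so K loses almost no pressure. *)

(** * Net contents on symbolic names and their continuity along increasing sets *)

Section NetContent.
Variables (R : realType) (X : Type) (name : X -> nat -> nat).
Variables (c : seq nat -> \bar R) (N : nat).
Hypothesis c_ge0 : forall u, (0 <= c u)%E.

Definition word_cover (G : set (seq nat)) (E : set X) :=
  (forall u, G u -> (N <= size u)%N) /\
  (forall x, E x -> exists b, G (mkseq (name x) b)).

(** Symbolic counterpart of [MB] with the length bound [N] kept fixed: cylinders of weight [c]
    replace Bowen balls. *)
Definition net_content (E : set X) : \bar R :=
  ereal_inf [set (\esum_(u in G) c u)%E | G in [set G | word_cover G E]].

(** The cylinders of these words are pairwise disjoint and cover the same points as those of [G]. *)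
Definition shortest (G : set (seq nat)) : set (seq nat) :=
  [set u | G u /\ forall b, (b < size u)%N -> ~ G (take b u)].

Lemma take_mkseq (f : nat -> nat) m n :
  (m <= n)%N -> take m (mkseq f n) = mkseq f m.
Proof. by move=> mn; rewrite /mkseq -map_take take_iota (minn_idPl mn). Qed.

Lemma shortest_cover G E : word_cover G E -> word_cover (shortest G) E.
Proof.
move=> [GN GE]; split=> [u [/GN]//|x /GE ex].
have ex' : exists b, `[< G (mkseq (name x) b) >].
  by case: ex => b Gb; exists b; apply/asboolP.
case: (ex_minnP ex') => b /asboolP Gb bmin; exists b; split=> // b'.
rewrite size_mkseq => b'b; rewrite (take_mkseq _ (ltnW b'b)) => Gb'.
by have := bmin b' (asboolT Gb'); rewrite leqNgt b'b.
Qed.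

(* Strong subadditivity: the words discarded on passing to the shortest words
   of [U `|` G] still cover [E], because any two prefixes of a name are
   comparable. *)
Lemma net_content_submodular U G E : word_cover U E -> word_cover G E ->
  (\esum_(u in shortest (U `|` G)) c u + net_content E <=
   \esum_(u in shortest U) c u + \esum_(u in G) c u)%E.
Proof.
move=> Ucov Gcov.
have [SN SE] := shortest_cover Ucov; have [GN GE] := Gcov.
set S := shortest U in SN SE *; set M := shortest (U `|` G).
(* The words common to [S] and [G] serve when two prefixes of a name coincide; their cost occurs
   twice on the right. *)
pose Q := [set u | (S u /\ ~ M u) \/ (G u /\ ~ M u) \/ (S u /\ G u)].
have Qcov : word_cover Q E.
  split=> [u [[/SN]|[[/GN]|[/SN]]]//|x Ex].
  have [b Sb] := SE _ Ex; have [b' Gb'] := GE _ Ex.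
  have [bb'|bb'|bb'] := ltngtP b b'.
  - exists b'; right; left; split=> // -[_ /(_ b)].
    rewrite size_mkseq (take_mkseq _ (ltnW bb')) => /(_ bb'); apply.
    by left; case: Sb.
  - exists b; left; split=> // -[_ /(_ b')].
    rewrite size_mkseq (take_mkseq _ (ltnW bb')) => /(_ bb'); apply.
    by right.
  - by exists b; right; right; rewrite {2}bb'.
apply: (@le_trans _ _ (\esum_(u in M) c u + \esum_(u in Q) c u)%E).
  by apply: leeD => //; apply: ereal_inf_lbound; exists Q.
rewrite (esum_mkcond M) (esum_mkcond Q) (esum_mkcond S) (esum_mkcond G).
have ite0 (A : set (seq nat)) u : (0 <= if u \in A then c u else 0)%E.
  by case: ifP.
rewrite -!esumD//; apply: le_esum => u _.
have MSG : M u -> S u \/ G u.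
  case=> -[Uu|]; last by right.
  by move=> h; left; split=> // b /h h' ?; apply: h'; left.
case: ifPn; rewrite ?notin_setE ?in_setE => Mu;
case: ifPn; rewrite ?notin_setE ?in_setE => Qu;
case: ifPn; rewrite ?notin_setE ?in_setE => Su;
case: ifPn; rewrite ?notin_setE ?in_setE => Gu; rewrite ?adde0 ?add0e//.
all: try by [exfalso; rewrite /Q /= in Qu; tauto | rewrite leeDl | rewrite adde_ge0].
Qed.

(** Near-optimal covers of the [E n] are merged one after another; by submodularity each merge costs
    only its own error, and the errors sum to at most [e]. *)
Lemma net_content_incr (E : nat -> set X) (r : R) :
  (forall n, E n `<=` E n.+1) ->
  (forall n, (net_content (E n) <= r%:E)%E) ->
  (net_content (\bigcup_n E n) <= r%:E)%E.
Proof.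
move=> Emono Er; apply/lee_addgt0Pr => e e0.
have cE_ge0 n : (0 <= net_content (E n))%E.
  by apply: le_ereal_inf_tmp => _ [G _ <-]; apply: esum_ge0.
have cE_fin n : net_content (E n) \is a fin_num.
  by rewrite ge0_fin_numE// (le_lt_trans (Er n)) ?ltry.
pose t n : R := fine (net_content (E n)).
pose dlt n : R := e / (2 ^+ n.+1).
have dlt0 n : 0 < dlt n by rewrite divr_gt0// exprn_gt0.
have Gex n : exists G, word_cover G (E n) /\
    (\esum_(u in G) c u <= (t n + dlt n)%:E)%E.
  have [_ [G GE <-] lt] := lb_ereal_inf_adherent (dlt0 n) (cE_fin n).
  by exists G; split=> //; rewrite EFinD fineK// ltW.
have {Gex}[G GP] := choice Gex.
pose U n := [set u | exists2 i, (i <= n)%N & G i u].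
have US n : U n.+1 = U n `|` G n.+1.
  apply/seteqP; split=> u.
    move=> [i]; rewrite leq_eqVlt => /predU1P[->|]; first by right.
    by rewrite ltnS => ? ?; left; exists i.
  by move=> [[i iln]|Gu]; [exists i => //; rewrite ltnW | exists n.+1].
have Ucov n : word_cover (U n) (E n).
  split=> [u [i _ /(proj1 (GP i).1)]//|x /(proj2 (GP n).1)[b Gb]].
  by exists b, n.
have sumU n : (\esum_(u in shortest (U n)) c u <=
               (t n + \sum_(i < n.+1) dlt i)%:E)%E.
  elim: n => [|n IH].
    rewrite big_ord_recr big_ord0 /= add0r.
    apply: le_trans (GP 0).2; rewrite (esum_mkcond (shortest _)) (esum_mkcond (G 0)).
    apply: le_esum => u _; case: ifPn => [|_]; last by case: ifP.
    rewrite in_setE => -[[i]]; rewrite leqn0 => /eqP-> G0 _.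
    by rewrite ifT// in_setE.
  (* [G n.+1] also covers the smaller [E n], so submodularity applies to [E n], and its finite
     content [t n] cancels. *)
  have GE : word_cover (G n.+1) (E n).
    split=> [|x /Emono]; first exact: (proj1 (GP n.+1).1).
    exact: (proj2 (GP n.+1).1).
  have := net_content_submodular (Ucov n) GE.
  rewrite -US -(fineK (cE_fin n)) -/(t n) => /le_trans.
  move=> /(_ _ (leeD IH (GP n.+1).2)).
  rewrite -leeBrDr// => /le_trans; apply; rewrite -!EFinD.
  by rewrite lee_fin [in leRHS]big_ord_recr /=; lra.
have sumdlt n : \sum_(i < n) dlt i <= e.
  suff -> : \sum_(i < n) dlt i = e - e / 2 ^+ n.
    by rewrite gerBl divr_ge0 ?ltW// exprn_gt0.
  elim: n => [|n IH]; first by rewrite big_ord0 expr0 divr1 subrr.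
  rewrite big_ord_recr /= IH /dlt exprS.
  have := @expf_neq0 R 2 n; rewrite pnatr_eq0 => /(_ isT) ?.
  by field.
have tr n : t n <= r by rewrite -lee_fin fineK.
pose V := [set u | exists i, G i u].
have Vcov : word_cover V (\bigcup_n E n).
  split=> [u [i /(proj1 (GP i).1)]//|x [n _ /(proj2 (GP n).1)[b Gb]]].
  by exists b, n.
apply: (@le_trans _ _ (\esum_(u in shortest V) c u)%E).
  by apply: ereal_inf_lbound; exists (shortest V) => //; exact: shortest_cover.
(* It suffices to bound finite subsums. Finitely many words minimal in [V] lie in some [U n], and
   are minimal there since [U n] is part of [V]. *)
apply: ge_ereal_sup => _ [F [finF FV] <-].
have [n Fn] : exists n, F `<=` U n.
  have /choice[h hP] : forall u, exists i, F u -> G i u.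
    move=> u; case: (pselect (F u)) => [/FV[[i Gi] _]|]; last by exists 0%N.
    by exists i.
  have /finite_seqP[s Fs] := finF.
  exists (\max_(u <- s) h u) => u Fu; exists (h u); last exact: hP.
  by apply: leq_bigmax_seq => //; move: Fu; rewrite Fs.
have FU : F `<=` shortest (U n).
  move=> u Fu; split; first exact: Fn.
  by move=> b /(proj2 (FV _ Fu)) h [i _ Gi]; apply: h; exists i.
rewrite -EFinD; apply: (@le_trans _ _ (\esum_(u in shortest (U n)) c u)%E).
  by apply: ereal_sup_ubound; exists F.
by apply: (le_trans (sumU n)); rewrite lee_fin lerD.
Qed.

End NetContent.

(** * Boxes of the Baire space *)

Section BaireSpace.

(** Dependent choice along words: successive words extend one another, so entry [i] of the branch is
    read off the word of length [i.+1]. *)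
Lemma mkseq_choice (P : seq nat -> Prop) :
  P [::] -> (forall u, P u -> exists m, P (rcons u m)) ->
  exists a : nat -> nat, forall j, P (mkseq a j).
Proof.
move=> P0 PS.
have /choice[h hP] : forall u, exists m, P u -> P (rcons u m).
  move=> u; case: (pselect (P u)) => [/PS[m Pm]|]; first by exists m.
  by exists 0%N.
pose w j := iter j (fun u => rcons u (h u)) [::].
have sw j : size (w j) = j by elim: j => //= j IH; rewrite size_rcons IH.
exists (fun i => nth 0%N (w i.+1) i) => j.
suff -> : mkseq (fun i => nth 0%N (w i.+1) i) j = w j.
  by elim: j => //= j; apply: hP.
elim: j => // j IH; rewrite mkseqS IH /= nth_rcons.
have -> : size (iter j (fun u => rcons u (h u)) [::]) = j by exact: sw.
by rewrite ltnn eqxx.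
Qed.

Definition below (b : nat -> nat) (k : nat) : set (nat -> nat) :=
  [set a | forall i, (i < k)%N -> (a i <= b i)%N].

(** Choquet's argument: bounding one more coordinate by [m] gives sets that increase with [m] and
    exhaust the previous one, so some [m] keeps the image from being small. *)
Lemma capacitability (X : Type) (g : (nat -> nat) -> X) (small : set X -> Prop) :
  (forall E : nat -> set X, (forall n, E n `<=` E n.+1) ->
     (forall n, small (E n)) -> small (\bigcup_n E n)) ->
  ~ small (range g) ->
  exists b, forall k, ~ small (g @` below b k).
Proof.
move=> incr nsmall.
pose A (u : seq nat) := [set a | forall i, (i < size u)%N -> (a i <= nth 0%N u i)%N].
have [|u nu|b bP] := @mkseq_choice (fun u => ~ small (g @` A u)).
- suff -> : A [::] = setT by [].
  by apply/seteqP.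
- apply: contrapT => /forallNP h; apply: nu.
  suff -> : g @` A u = \bigcup_m (g @` A (rcons u m)).
    apply: incr => [m _ [a Aa <-]|m]; last exact: contrapT (h m).
    exists a => // i im; apply: (leq_trans (Aa i _)); first by move: im; rewrite !size_rcons.
    by rewrite !nth_rcons; case: ifP => //; case: ifP.
  apply/seteqP; split=> [_ [a Aa <-]|_ [m _ [a Aa <-]]].
    exists (a (size u)) => //; exists a => // i.
    rewrite size_rcons ltnS nth_rcons leq_eqVlt => /predU1P[->|iu].
      by rewrite ltnn eqxx.
    by rewrite iu; apply: Aa.
  exists a => // i iu; have := Aa i; rewrite size_rcons nth_rcons iu; apply.
  exact: ltnW.
- exists b => k; suff -> : below b k = A (mkseq b k) by exact: bP.
  by apply/seteqP; split=> a; rewrite /A /= size_mkseq => h i ik;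
    have := h i ik; rewrite nth_mkseq.
Qed.

(* Koenig's lemma, in a form that gives at once the compactness of the image of
   a box of the Baire space and a truncated box inside a given neighbourhood. *)
Lemma box_cover (R : realType) (X : Type) (d : X -> X -> R)
    (g : (nat -> nat) -> X) (b : nat -> nat) (F : set (set X)) :
  (forall a (e : R), 0 < e -> exists k : nat, forall a' : nat -> nat,
     (forall i, (i < k)%N -> a' i = a i) -> d (g a) (g a') < e) ->
  (forall U, F U -> d_open d U) ->
  g @` [set a | forall i, (a i <= b i)%N] `<=` \bigcup_(U in F) U ->
  exists (s : seq (set X)) (k : nat), (forall U, U \in s -> F U) /\
    g @` below b k `<=` (fun x => exists2 U, U \in s & U x).
Proof.
move=> gcont Fopen cov.
(* A word is good if the sequences that extend it inside some truncation of the box have a finite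
   subcover. If the empty word is bad, an infinite branch of bad words bounded by [b] results. *)
pose good u := exists (s : seq (set X)) (k : nat), (forall U, U \in s -> F U) /\
  forall a, mkseq a (size u) = u -> below b k a -> exists2 U, U \in s & U (g a).
have [[s [k [sF sP]]]|bad] := pselect (good [::]).
  by exists s, k; split=> // _ [a ba <-]; apply: sP.
exfalso.
have [|u [nu ub]|a aP] := @mkseq_choice
  (fun u => ~ good u /\ forall i, (i < size u)%N -> (nth 0%N u i <= b i)%N).
- by [].
- apply: contrapT => /forallNP h; apply: nu.
  have /choice[sk skP] : forall m, exists sk : seq (set X) * nat,
      (m <= b (size u))%N -> (forall U, U \in sk.1 -> F U) /\
      forall a, mkseq a (size u).+1 = rcons u m -> below b sk.2 a ->
        exists2 U, U \in sk.1 & U (g a).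
    move=> m; have [mb|] := boolP (m <= b (size u))%N; last by exists ([::], 0%N).
    have [] : good (rcons u m).
      apply: contrapT => ngood; apply: (h m); split=> // i.
      rewrite size_rcons ltnS nth_rcons leq_eqVlt => /predU1P[->|iu].
        by rewrite ltnn eqxx.
      by rewrite iu; apply: ub.
    by rewrite size_rcons => s [k skP]; exists (s, k).
  set r := iota 0 (b (size u)).+1.
  exists (flatten [seq (sk m).1 | m <- r]).
  (* The first term makes the truncation bound coordinate [size u], leaving finitely many children;
     the second dominates the depths they require. *)
  exists (maxn (size u).+1 (\max_(m <- r) (sk m).2)); split.
    move=> U /flatten_mapP[m]; rewrite mem_iota add0n ltnS => /andP[_ mb].
    exact: (skP m mb).1.
  move=> a au ab; set m := a (size u).
  have mb : (m <= b (size u))%N by apply: ab; rewrite leq_max ltnSn.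
  have mr : m \in r by rewrite mem_iota add0n ltnS mb.
  have [_ /(_ a)] := skP m mb.
  rewrite mkseqS au => /(_ erefl) [|U Us Ug].
    move=> i ik; apply: ab; rewrite leq_max; apply/orP; right.
    by apply: (leq_trans ik); apply: leq_bigmax_seq.
  by exists U => //; apply/flatten_mapP; exists m.
(* The branch lies in the box, so by continuity all sequences sharing a long prefix with it are sent
   into one [U]: that prefix is good. *)
- have ab i : (a i <= b i)%N.
    by have := (aP i.+1).2 i; rewrite size_mkseq nth_mkseq//; apply.
  have [|U FU Ua] := cov (g a); first by exists a.
  have [r r0 rU] := Fopen _ FU _ Ua; have [k kP] := gcont a r r0.
  apply: (aP k).1; exists [:: U], 0%N; split=> [V|a']; first by rewrite inE => /eqP->.
  rewrite size_mkseq => a'a _; exists U; first by rewrite inE.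
  apply: rU; apply: kP => i ik.
  by have := congr1 (nth 0%N ^~ i) a'a; rewrite !nth_mkseq.
Qed.

End BaireSpace.

(** * Compactness arguments, Bowen balls and labels of orbit blocks *)

Section CompactMetric.
Variables (R : realType) (X : Type) (d : X -> X -> R).
Hypothesis d_metric : is_metric d.

Lemma dist_refl x : d x x = 0. Proof. by case: d_metric => _ /(_ x x)[_ ->]. Qed.

Lemma dist_sym x y : d x y = d y x. Proof. by case: d_metric. Qed.

Lemma dist_triangle x y z : d x z <= d x y + d y z. Proof. by case: d_metric. Qed.

Lemma dball_open x r : d_open d (dball d x r).
Proof.
move=> y; rewrite /dball /= => xy; exists (r - d x y); first by rewrite subr_gt0.
by move=> z /= yz; have := dist_triangle x y z; lra.
Qed.

Hypothesis X_compact : d_compact d setT.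

(** Compactness as an induction on sets; uniform continuity, boundedness and finite nets are
    instances. *)
Lemma compact_ind (P : set X -> Prop) :
  P set0 -> (forall A B, P A -> P B -> P (A `|` B)) ->
  (forall A B, A `<=` B -> P B -> P A) ->
  (forall x, exists2 r : R, 0 < r & P (dball d x r)) -> P setT.
Proof.
move=> P0 PU PS Ploc.
have [||s [sP cov]] := @X_compact [set U | d_open d U /\ P U].
- by move=> U [].
- move=> x _; have [r r0 Pr] := Ploc x; exists (dball d x r) => /=.
    by split=> //; exact: dball_open.
  by rewrite /dball /= dist_refl.
apply: (PS _ _ cov); elim: s sP {cov} => [|U s IH] sP.
  by apply: PS P0 => x [].
apply: (PS _ (U `|` (fun x => exists2 V, V \in s & V x))).
  move=> x [V]; rewrite inE => /predU1P[->|Vs] Vx; [by left|right; by exists V].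
apply: PU; first by case: (sP U (mem_head _ _)).
by apply: IH => V Vs; apply: sP; rewrite inE Vs orbT.
Qed.

Lemma unif_cont (f : X -> R) (t : R) : d_continuous_real d f -> 0 < t ->
  exists2 e : R, 0 < e & forall x y, d x y < e -> `|f x - f y| < t.
Proof.
move=> fc t0.
suff [e e0 h] : exists2 e : R, 0 < e &
    forall x, setT x -> forall y, d x y < e -> `|f x - f y| < t.
  by exists e => // x y; apply: h.
apply: (@compact_ind (fun A => exists2 e : R, 0 < e &
    forall x, A x -> forall y, d x y < e -> `|f x - f y| < t)).
- by exists 1.
- move=> A B [e e0 eA] [r r0 rB]; exists (Num.min e r).
    by rewrite lt_min e0 r0.
  by move=> x [Ax|Bx] y; rewrite lt_min => /andP[xe xr]; [apply: eA|apply: rB].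
- by move=> A B AB [e e0 eB]; exists e => // x /AB; apply: eB.
- move=> x; have [r r0 rP] := fc x (t / 2) ltac:(lra).
  exists (r / 2); first lra.
  exists (r / 2); first lra.
  move=> y; rewrite /dball /= => xy z yz.
  have xz : d x z < r by have := dist_triangle x y z; lra.
  have xyr : d x y < r by lra.
  have := rP _ xz; have := rP _ xyr; rewrite !ltr_norml.
  by move=> /andP[? ?] /andP[? ?]; apply/andP; split; lra.
Qed.

Lemma cont_bounded (f : X -> R) : d_continuous_real d f ->
  exists B : R, forall x, `|f x| <= B.
Proof.
move=> fc.
suff [B h] : exists B : R, forall x, setT x -> `|f x| <= B.
  by exists B => x; apply: h.
apply: (@compact_ind (fun A => exists B : R, forall x, A x -> `|f x| <= B)).
- by exists 0.
- move=> A B [a aA] [b bB]; exists (Num.max a b).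
  by move=> x [/aA|/bB]; rewrite le_max => ->; rewrite ?orbT.
- by move=> A B AB [b bB]; exists b => x /AB; apply: bB.
- move=> x; have [r r0 rP] := fc x 1 ltr01.
  exists r => //; exists (`|f x| + 1) => y /rP xy.
  have := ler_normB (f x) (f x - f y); rewrite subKr; lra.
Qed.

Lemma finite_net (r : R) : 0 < r -> exists (p : nat) (c : 'I_p -> X),
  forall x, exists j, d (c j) x < r.
Proof.
move=> r0.
suff [p [c h]] : exists (p : nat) (c : 'I_p -> X),
    forall x, setT x -> exists j, d (c j) x < r.
  by exists p, c => x; apply: h.
apply: (@compact_ind (fun A => exists (p : nat) (c : 'I_p -> X),
  forall x, A x -> exists j, d (c j) x < r)).
- by exists 0%N, (fun j : 'I_0 => False_rect X (notF (ltn_ord j))).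
- move=> A B [p [c cA]] [q [c' cB]].
  exists (p + q)%N, (fun j => match fintype.split j with inl i => c i | inr i => c' i end).
  move=> x [/cA|/cB] [j jx].
    by exists (lshift q j); rewrite (unsplitK (inl j)).
  by exists (rshift p j); rewrite (unsplitK (inr j)).
- by move=> A B AB [p [c cB]]; exists p, c => x /AB; apply: cB.
- by move=> x; exists r => //; exists 1%N, (fun=> x) => y; exists ord0.
Qed.

Variable T : X -> X.
Hypothesis T_cont : d_continuous_self d T.

Lemma dn_ltP n x y (e : R) : 0 < e ->
  (dn d T n x y < e) <-> (forall i, (i < n)%N -> d (iter i T x) (iter i T y) < e).
Proof.
move=> e0; split=> [/bigmax_ltP[_ h] i il|h]; first exact: (h (Ordinal il)).
by apply/bigmax_ltP; split=> // i _; apply: h.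
Qed.

Lemma Bn_center n x (e : R) : 0 < e -> Bn d T n x e x.
Proof. by move=> e0; apply/dn_ltP => // i _; rewrite dist_refl. Qed.

Lemma Bn_subset m n x (e r : R) : (m <= n)%N -> 0 < e -> e <= r ->
  Bn d T n x e `<=` Bn d T m x r.
Proof.
move=> mn e0 er y /dn_ltP h; apply/dn_ltP; first exact: lt_le_trans er.
by move=> i im; apply: lt_le_trans er; apply: h => //; apply: leq_trans mn.
Qed.

Lemma orbit_cont n x (e : R) : 0 < e -> exists2 r : R, 0 < r &
  forall y, d x y < r -> forall i, (i < n)%N -> d (iter i T x) (iter i T y) < e.
Proof.
move=> e0; elim: n => [|n [r r0 rP]]; first by exists 1.
have [q q0 qP] : exists2 q : R, 0 < q &
    forall y, d x y < q -> d (iter n T x) (iter n T y) < e.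
  elim: n {r r0 rP} e e0 => [|n IH] e e0; first by exists e.
  have [a a0 aP] := T_cont (iter n T x) e0.
  by have [q q0 qP] := IH a a0; exists q => // y /qP /aP.
exists (Num.min r q); first by rewrite lt_min r0 q0.
move=> y; rewrite lt_min => /andP[xr xq] i.
by rewrite ltnS leq_eqVlt => /predU1P[->|]; [apply: qP|apply: rP].
Qed.

Lemma Bn_open n x (e : R) : 0 < e -> d_open d (Bn d T n x e).
Proof.
move=> e0 y xy; have xy' : dn d T n x y < e by [].
have [r r0 rP] := @orbit_cont n y (e - dn d T n x y) ltac:(by rewrite subr_gt0).
exists r => // z /rP h; apply/dn_ltP => // i il.
have := dist_triangle (iter i T x) (iter i T y) (iter i T z).
have : d (iter i T x) (iter i T y) <= dn d T n x y.
  by rewrite /dn; apply: (@le_bigmax _ _ _ 0 (fun i : 'I_n => d (iter i T x) (iter i T y)) (Ordinal il)).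
by have := h i il; lra.
Qed.

Lemma fsum_close (f : X -> R) (e t : R) n x y : 0 < e ->
  (forall x y, d x y < e -> `|f x - f y| < t) ->
  Bn d T n x e y -> fsum T f n y <= fsum T f n x + n%:R * t.
Proof.
move=> e0 ft /dn_ltP h; rewrite /fsum -lerBlDl -sumrB.
rewrite -[X in _ <= X%:R * _]card_ord mulr_natl -sumr_const; apply: ler_sum => i _.
have /ltW := ft _ _ (h e0 i (ltn_ord i)); rewrite distrC.
by apply: le_trans; exact: ler_norm.
Qed.

(* With more than [p * k] radii, the annuli of half-width [eta] around the
   spheres of those radii cannot all meet the first [k] points of the orbit of
   [x]; a radius whose annuli are avoided labels nearby orbits identically. *)
Lemma block_label (e : R) : 0 < e -> exists p : nat, forall k : nat,
  exists (eta : R) (lab : X -> nat) (lam : nat -> X -> nat),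
    [/\ 0 < eta, forall x y, lab x = lab y -> Bn d T k x e y &
       forall x y, Bn d T k x eta y ->
         exists2 l, (l < (p * k).+1)%N & lab y = lam l x].
Proof.
move=> e0; have [p [c cP]] := @finite_net (e / 4) ltac:(lra).
exists p => k; set L := (p * k).+1.
(* For [l < L] the radii lie in [[e/4, e/2)]: balls this large cover the space, and two points of
   one such ball are [e]-close. Consecutive radii differ by [2 * eta]. *)
pose rad (l : nat) : R := e / 4 + e / 4 * (l%:R / L%:R).
pose eta : R := e / 8 / L%:R.
have L0 : (0 : R) < L%:R by rewrite ltr0n.
have eta0 : 0 < eta by rewrite divr_gt0//; lra.
pose avoids l x := forall (i : 'I_k) (j : 'I_p), eta <= `|d (c j) (iter i T x) - rad l|.
have /choice[sel selP] : forall x, exists l, (l < L)%N /\ avoids l x.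
  move=> x; apply: contrapT => /forallNP nav.
  have /choice[h hP] : forall l : 'I_L, exists ij : 'I_k * 'I_p,
      `|d (c ij.2) (iter ij.1 T x) - rad l| < eta.
    move=> l; apply: contrapT => /forallNP hl; apply: (nav l); split=> // i j.
    by rewrite leNgt; apply/negP; apply: (hl (i, j)).
  (* Radii spoiled by the same time and centre differ by less than the spacing [2 * eta], hence
     coincide; but there are only [k * p] such pairs. *)
  have : injective h.
    move=> l l' ll'; have := hP l; have := hP l'; rewrite -ll'.
    set D := d _ _ => h1 h2; apply/val_inj/eqP; apply: contraT => neq.
    have : 1 <= `|(l%:R : R) - l'%:R|.
      have gap (m n : nat) : (m < n)%N -> 1 <= `|(n%:R : R) - m%:R|.
        by move=> mn; rewrite -natrB ?(ltnW mn)// ger0_norm// ler1n subn_gt0.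
      have := neq; rewrite neq_ltn => /orP[] /gap //.
      by rewrite distrC.
    have : `|rad l - rad l'| < eta + eta.
      have -> : rad l - rad l' = (D - rad l') - (D - rad l) by ring.
      by apply: (le_lt_trans (ler_normB _ _)); apply: ltrD.
    have -> : rad l - rad l' = (eta + eta) * (l%:R - l'%:R).
      by rewrite /rad /eta; field; rewrite gt_eqF.
    rewrite normrM [X in X * _]gtr0_norm; last lra.
    move=> h3 h4; have : (eta + eta) * 1 <= (eta + eta) * `|(l%:R : R) - l'%:R|.
      by rewrite ler_wpM2l//; lra.
    lra.
  by move=> /leq_card; rewrite card_prod !card_ord mulnC ltnn.
(* The symbol is a centre whose sphere encloses the point. The label packs the radius index with the
   itinerary, so that equal labels share both. *)
pose sym l x := [pick j | d (c j) x < rad l].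
pose lam l x := pickle (l, [seq sym l (iter i T x) | i <- iota 0 k]).
exists eta, (fun x => lam (sel x) x), lam; split=> // x y.
  move=> /(pcan_inj pickleK)[<-] /eq_in_map eqs; apply/(dn_ltP _ _ _ e0) => i ik.
  have [lL _] := selP x.
  have {eqs} : sym (sel x) (iter i T x) = sym (sel x) (iter i T y).
    by apply: eqs; rewrite mem_iota.
  have rad4 : e / 4 <= rad (sel x).
    by rewrite lerDl mulr_ge0// ?divr_ge0//; lra.
  have rad2 : rad (sel x) < e / 2.
    have : e / 4 * ((sel x)%:R / L%:R) < e / 4 * 1.
      by rewrite ltr_pM2l ?ltr_pdivrMr ?mul1r ?ltr_nat//; lra.
    by rewrite /rad; lra.
  rewrite /sym; case: pickP => [j jx|none _].
    case: pickP => // j' j'y [jj']; rewrite -jj' in j'y.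
    have := dist_triangle (iter i T x) (c j) (iter i T y).
    by rewrite (dist_sym _ (c j)); lra.
  have [j jx] := cP (iter i T x).
  by have := none j; rewrite (lt_le_trans jx rad4).
(* The radius is the one selected for [y]: its orbit avoids the annuli, so a displacement below
   [eta] crosses no sphere. *)
move=> /dn_ltP xy; exists (sel y); first by have [] := selP y.
congr (pickle (_, _)); apply/eq_in_map => i; rewrite mem_iota add0n => /andP[_ ik].
apply: eq_pick => j; have [_ /(_ (Ordinal ik) j) /= av] := selP y.
have := xy eta0 i ik.
have := dist_triangle (c j) (iter i T x) (iter i T y).
have := dist_triangle (c j) (iter i T y) (iter i T x).
rewrite (dist_sym (iter i T y)) => h1 h2 h3.
move: av; rewrite ler_normr => /orP[av|av]; apply/idP/idP => ?; lra.
Qed.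

End CompactMetric.

(** * Limits and sums in the extended reals *)

Section ExtendedReals.
Variable R : realType.

Lemma ereal_between (x y : \bar R) :
  (x < y)%E -> exists r : R, (x < r%:E)%E /\ (r%:E < y)%E.
Proof.
case: x y => [x| |] [y| |] //.
- rewrite lte_fin => xy; exists ((x + y) / 2); rewrite !lte_fin; split; lra.
- by move=> _; exists (x + 1); rewrite lte_fin ltry ltrDl.
- by move=> _; exists (y - 1); rewrite lte_fin ltNyr gtrBl.
- by move=> _; exists 0; rewrite ltNyr ltry.
Qed.

Lemma cvge_between (T : Type) (F : set_system T) (FF : Filter F)
    (h : T -> \bar R) (l : \bar R) :
  (forall a : R, (a%:E < l)%E -> \forall x \near F, (a%:E < h x)%E) ->
  (forall b : R, (l < b%:E)%E -> \forall x \near F, (h x < b%:E)%E) ->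
  h x @[x --> F] --> l.
Proof.
case: l => [l| |] lo up.
- apply/fine_cvgP; split.
    have lo1 := lo (l - 1) ltac:(by rewrite lte_fin gtrBl).
    have up1 := up (l + 1) ltac:(by rewrite lte_fin ltrDl).
    near=> x; rewrite fin_numElt (@lt_trans _ _ (l - 1)%:E) ?ltNyr//=; last first.
      by near: x.
    by rewrite (@lt_trans _ _ (l + 1)%:E) ?ltry//; near: x.
  apply/cvgrPdist_lt => e e0.
  have lo1 := lo (l - e) ltac:(by rewrite lte_fin gtrBl).
  have up1 := up (l + e) ltac:(by rewrite lte_fin ltrDl).
  near=> x.
  have : ((l - e)%:E < h x)%E by near: x.
  have : (h x < (l + e)%:E)%E by near: x.
  rewrite /=; case: (h x) => // r; rewrite !lte_fin /= => *.
  by rewrite ltr_norml; apply/andP; split; lra.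
- by apply/cvgeyPgt => a; apply: lo; rewrite ltry.
- by apply/cvgeNyPlt => a; apply: up; rewrite ltNyr.
Unshelve. all: by end_near. Qed.

(** The limit is the supremum of the eventual lower bounds, and [h e - t] is one of them for small
    [e]. This serves [PB_eps], monotone in the scale up to the oscillation of [f]. *)
Lemma almost_nonincreasing_cvg (h : R -> \bar R) :
  (forall t : R, 0 < t -> exists2 e0 : R, 0 < e0 &
     forall e e', 0 < e' -> e' <= e -> e < e0 -> (h e <= h e' + t%:E)%E) ->
  cvg (h e @[e --> 0^'+]).
Proof.
move=> hmon.
pose A := [set v : \bar R | exists2 e0 : R, 0 < e0 &
  forall e, 0 < e -> e < e0 -> (v <= h e)%E].
apply/cvg_ex; exists (ereal_sup A); apply: cvge_between => [a|b].
  move=> /ereal_sup_gt[v [e0 e00 vh] av]; near=> e.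
  by apply: (lt_le_trans av); apply: vh => //; near: e; exact: nbhs_right_lt.
move=> /ereal_between[b' [lb' b'b]].
have [e0 e00 e0P] := hmon (b - b') ltac:(by rewrite subr_gt0 -lte_fin).
near=> e.
have e_gt0 : 0 < e by [].
have ee0 : e < e0 by near: e; exact: nbhs_right_lt.
have hA : A (h e - (b - b')%:E)%E.
  by exists e => // e' e'0 /ltW e'e; rewrite leeBlDr//; apply: e0P.
have := le_lt_trans (ereal_sup_ubound hA) lb'.
by rewrite lteBlDr// -EFinD addrCA subrr addr0.
Unshelve. all: by end_near. Qed.

Lemma esum_subset (T : choiceType) (A B : set T) (a : T -> \bar R) :
  (forall x, (0 <= a x)%E) -> A `<=` B ->
  (\esum_(x in A) a x <= \esum_(x in B) a x)%E.
Proof.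
move=> a0 AB; rewrite (esum_mkcond A) (esum_mkcond B); apply: le_esum => x _.
case: ifPn => [|_]; first by rewrite in_setE => /AB Bx; rewrite ifT// in_setE.
by case: ifP.
Qed.

(** Choosing one preimage per point of the image is injective, so the left side equals a subsum of
    the right. *)
Lemma esum_image_le (T T' : choiceType) (A : set T) (h : T -> T') (a : T' -> \bar R) :
  (forall x, (0 <= a x)%E) ->
  (\esum_(y in h @` A) a y <= \esum_(x in A) a (h x))%E.
Proof.
move=> a0.
have [x0|A0] := pselect (exists x, A x); last first.
  rewrite (_ : h @` A = set0) ?esum_set0 ?esum_ge0//.
  by apply/seteqP; split=> // y [x Ax _]; apply: A0; exists x.
have [x1 _] := x0.
have /choice[q qP] : forall y, exists x, (h @` A) y -> A x /\ h x = y.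
  move=> y; have [[x Ax xy]|] := pselect ((h @` A) y); first by exists x.
  by exists x1.
rewrite (@eq_esum _ _ _ a (fun y => a (h (q y)))); last by move=> y /qP[_ ->].
rewrite -(@reindex_esum _ _ _ (h @` A) (q @` (h @` A)) q (fun x => a (h x))).
  by apply: esum_subset => // _ [y /qP[Ay _] <-].
apply: inj_bij => y y'; rewrite !in_setE => /qP[_ yE] /qP[_ y'E] yy'.
by rewrite -yE -y'E yy'.
Qed.

Lemma esum_bigcup_le (T T' : choiceType) (I : set T) (G : T -> set T')
    (a : T' -> \bar R) : (forall x, (0 <= a x)%E) ->
  (\esum_(y in \bigcup_(i in I) G i) a y <= \esum_(i in I) \esum_(y in G i) a y)%E.
Proof.
move=> a0; rewrite esum_esum//.
rewrite (_ : \bigcup_(i in I) G i = snd @` (I `*`` G)); first exact: esum_image_le.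
apply/seteqP; split=> [y [i Ii Gy]|y [[i z] [Ii Gz] /= <-]]; last by exists i.
by exists (i, y).
Qed.

Lemma esum_finType_const (T : finType) (v : \bar R) : (0 <= v)%E ->
  (\esum_(t in [set: T]) v = (#|T|%:R)%:E * v)%E.
Proof.
move=> v0; rewrite (_ : [set: T] = [set` enum T]); last first.
  by apply/seteqP; split=> t // _; rewrite /= mem_enum.
by rewrite esum_fset// -fsbig_seq ?enum_uniq// big_enum sumr_const mule_natl.
Qed.

Lemma esum_mull_le (T : choiceType) (I : set T) (r : R) (a : T -> \bar R) :
  0 <= r -> (forall x, (0 <= a x)%E) ->
  (\esum_(x in I) (r%:E * a x) <= r%:E * \esum_(x in I) a x)%E.
Proof.
move=> r0 a0; apply: ge_ereal_sup => _ [F [finF FI] <-].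
rewrite -ge0_mule_fsumr//; apply: lee_wpmul2l; first by rewrite lee_fin.
by apply: ereal_sup_ubound; exists F.
Qed.

End ExtendedReals.

(** * Bowen pressure at a fixed scale and in the limit *)

Section Pressure.
Variables (R : realType) (X : Type) (d : X -> X -> R) (T : X -> X) (f : X -> R).
Hypothesis d_metric : is_metric d.

Lemma esum_weight_ge0 s e xs ns I :
  (0 <= \esum_(i in I) cover_weight d T f s e xs ns i)%E.
Proof. by apply: esum_ge0 => i _; exact: expeR_ge0. Qed.

Lemma MB_ge0 Z s N e : (0 <= MB d T f Z s N e)%E.
Proof. by apply: le_ereal_inf_tmp => _ [I [xs [ns [_ ->]]]]; exact: esum_weight_ge0. Qed.

Lemma MB_nondecreasing Z s e :
  {homo (fun N => MB d T f Z s N e) : n m / (n <= m)%N >-> (n <= m)%E}.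
Proof.
move=> n m nm; apply: le_ereal_inf => _ [I [xs [ns [[nsN cov] ->]]]].
exists I, xs, ns; split=> //; split=> // i /nsN; exact: leq_trans.
Qed.

Lemma mBE Z s e :
  mB d T f Z s e = ereal_sup (range (fun N => MB d T f Z s N e)).
Proof. exact/cvg_lim/ereal_nondecreasing_cvgn/MB_nondecreasing. Qed.

Lemma mB_eq0 Z s e : mB d T f Z s e = 0%E <-> forall N, MB d T f Z s N e = 0%E.
Proof.
rewrite mBE; split=> [m0 N|M0].
  apply/eqP; rewrite eq_le MB_ge0 andbT -m0.
  by apply: ereal_sup_ubound; exists N.
apply/eqP; rewrite eq_le; apply/andP; split.
  by apply: ge_ereal_sup => _ [N _ <-]; rewrite M0.
by rewrite -(M0 0%N); apply: ereal_sup_ubound; exists 0%N.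
Qed.

Lemma MB_le_exponent Z s s' N e : s' <= s ->
  (MB d T f Z s N e <= MB d T f Z s' N e)%E.
Proof.
move=> ss'; apply: le_ereal_inf_tmp => _ [I [xs [ns [cov ->]]]].
apply: (@le_trans _ _ (\esum_(i in I) cover_weight d T f s e xs ns i)%E).
  by apply: ereal_inf_lbound; exists I, xs, ns.
apply: le_esum => i _; rewrite lee_expeR leeD2r// lee_fin.
by rewrite ler_wpM2r// lerN2.
Qed.

(** [MB] is nonincreasing in the exponent, so a positive value at a single [N] excludes every real
    below [s] from the infimum. *)
Lemma PB_eps_ge Z s N e : (0 < MB d T f Z s N e)%E -> (s%:E <= PB_eps d T f Z e)%E.
Proof.
move=> M0; apply: le_ereal_inf_tmp => _ [s' /mB_eq0 m0 <-].
rewrite lee_fin leNgt; apply/negP => /ltW /(MB_le_exponent Z N e).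
by rewrite m0 leNgt M0.
Qed.

Lemma PB_eps_gt Z s e : (s%:E < PB_eps d T f Z e)%E ->
  exists N, (0 < MB d T f Z s N e)%E.
Proof.
move=> sP; apply: contrapT => /forallNP h.
have : mB d T f Z s e = 0%E.
  apply/mB_eq0 => N; apply/eqP; rewrite eq_le MB_ge0 andbT leNgt.
  exact/negP.
move=> m0; have : (PB_eps d T f Z e <= s%:E)%E.
  by apply: ereal_inf_lbound; exists s.
by rewrite leNgt sP.
Qed.

Lemma PB_eps_mono K Z e : K `<=` Z -> (PB_eps d T f K e <= PB_eps d T f Z e)%E.
Proof.
move=> KZ; apply: le_ereal_inf => _ [s /mB_eq0 m0 <-]; exists s => //=.
apply/mB_eq0 => N; apply/eqP; rewrite eq_le MB_ge0 andbT -(m0 N).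
apply: le_ereal_inf => _ [I [xs [ns [[nsN cov] ->]]]].
by exists I, xs, ns; split=> //; split=> // x /KZ /cov.
Qed.

Lemma sup_Bn_le n x (e t : R) : 0 < e ->
  (forall x y, d x y < e -> `|f x - f y| < t) ->
  (ereal_sup [set (fsum T f n y)%:E | y in Bn d T n x e] <=
   (fsum T f n x + n%:R * t)%:E)%E.
Proof.
move=> e0 ft; apply: ge_ereal_sup => _ [y xy <-]; rewrite lee_fin.
exact: (fsum_close e0 ft).
Qed.

Lemma PB_eps_almost_mono Z (e e' t : R) : 0 < e' -> e' <= e ->
  (forall x y, d x y < e -> `|f x - f y| < t) ->
  (PB_eps d T f Z e <= PB_eps d T f Z e' + t%:E)%E.
Proof.
move=> e'0 e'e ft; have e0 := lt_le_trans e'0 e'e.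
rewrite -leeBlDr//; apply: le_ereal_inf_tmp => _ [s /mB_eq0 m0 <-].
rewrite leeBlDr// -EFinD; apply: ereal_inf_lbound; exists (s + t) => //=.
apply/mB_eq0 => N; apply/eqP; rewrite eq_le MB_ge0 andbT -(m0 N).
apply: le_ereal_inf_tmp => _ [I [xs [ns [[nsN cov] ->]]]].
apply: (@le_trans _ _ (\esum_(i in I) cover_weight d T f (s + t) e xs ns i)%E).
  apply: ereal_inf_lbound; exists I, xs, ns; split=> //; split=> // x /cov[i Ii xi].
  by exists i => //; apply: (Bn_subset (leqnn _) e'0 e'e xi).
apply: le_esum => i _; rewrite lee_expeR.
have lo : ((fsum T f (ns i) (xs i))%:E <=
    ereal_sup [set (fsum T f (ns i) y)%:E | y in Bn d T (ns i) (xs i) e'])%E.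
  by apply: ereal_sup_ubound; exists (xs i) => //; exact: Bn_center.
apply: (le_trans (leeD2l _ (sup_Bn_le (ns i) (xs i) e0 ft))).
apply: le_trans (leeD2l _ lo); rewrite -!EFinD lee_fin; lra.
Qed.

Hypothesis X_compact : d_compact d setT.
Hypothesis f_cont : d_continuous_real d f.

Lemma PB_eps_cvg Z : cvg (PB_eps d T f Z e @[e --> 0^'+]).
Proof.
apply: almost_nonincreasing_cvg => t t0.
have [e0 e00 e0P] := unif_cont d_metric X_compact f_cont t0.
exists e0 => // e e' e'0 e'e ee0; apply: PB_eps_almost_mono => // x y xy.
by apply: e0P; apply: lt_trans ee0.
Qed.

Lemma PB_mono K Z : K `<=` Z -> (PB d T f K <= PB d T f Z)%E.
Proof.
move=> KZ; apply: (lee_lim (PB_eps_cvg (Z := K)) (PB_eps_cvg (Z := Z))).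
by near=> e; exact: PB_eps_mono.
Unshelve. all: by end_near. Qed.

End Pressure.

(** * Comparison of cylinder content with Bowen covers *)

Section BlockNames.
Variables (R : realType) (X : Type) (d : X -> X -> R) (T : X -> X) (f : X -> R).
Variables (k : nat) (lab : X -> nat).

Definition block_name (x : X) (j : nat) : nat := lab (iter (j * k) T x).

Definition cylinder (u : seq nat) : set X :=
  [set x | mkseq (block_name x) (size u) = u].

(** Counterpart of [cover_weight]: each letter stands for [k] steps. An empty cylinder has weight
    zero, its supremum being minus infinity. *)
Definition word_weight (a : R) (u : seq nat) : \bar R :=
  expeR ((- a * (size u * k)%:R)%:E +
         ereal_sup [set (fsum T f (size u * k) y)%:E | y in cylinder u])%E.

Lemma word_weight_ge0 a u : (0 <= word_weight a u)%E.
Proof. exact: expeR_ge0. Qed.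

Lemma fsum_truncate (B : R) m r y : (forall x, `|f x| <= B) ->
  fsum T f m y <= fsum T f (m + r) y + r%:R * B.
Proof.
move=> fB; elim: r => [|r IH]; first by rewrite addn0 mul0r addr0.
rewrite addnS {2}/fsum big_ord_recr /= -/(fsum T f (m + r) y) -natr1.
have := fB (iter (m + r) T y); rewrite ler_norml => /andP[+ _]; lra.
Qed.

Hypothesis k_gt0 : (0 < k)%N.

Lemma iter_divn i x : iter i T x = iter (i %% k) T (iter (i %/ k * k) T x).
Proof. by rewrite -iterD addnC -divn_eq. Qed.

Variables (e t : R).
Hypothesis e_gt0 : 0 < e.
Hypothesis f_close : forall x y, d x y < e -> `|f x - f y| < t.
Hypothesis lab_Bn : forall x y, lab x = lab y -> Bn d T k x e y.

Lemma cylinder_Bn u x y :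
  cylinder u x -> cylinder u y -> Bn d T (size u * k) x e y.
Proof.
rewrite /cylinder /= => xu yu; apply/(dn_ltP _ _ _ _ _ e_gt0) => i iu.
have ik : (i %/ k < size u)%N by rewrite ltn_divLR.
have : block_name x (i %/ k) = block_name y (i %/ k).
  by rewrite -[LHS](nth_mkseq 0%N _ ik) -[RHS](nth_mkseq 0%N _ ik) xu yu.
move=> /lab_Bn /(dn_ltP _ _ _ _ _ e_gt0) /(_ (i %% k)%N); rewrite ltn_mod.
by rewrite !(iter_divn i); apply.
Qed.

(** A nonempty cylinder lies in the Bowen ball of the same length about any of its points; the shift
    by [t] pays for the variation of [f] over that ball. *)
Lemma MB_le_net_content (x0 : X) (a : R) (N : nat) (E : set X) :
  (MB d T f E (a + t) N e <= net_content block_name (word_weight a) N E)%E.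
Proof.
apply: le_ereal_inf_tmp => _ [G [GN GE] <-].
have /choice[pt ptP] : forall u, exists x, cylinder u !=set0 -> cylinder u x.
  move=> u; have [[x ux]|] := pselect (cylinder u !=set0); first by exists x.
  by exists x0.
pose G' := [set u | G u /\ cylinder u !=set0].
pose w i := odflt [::] (unpickle i) : seq nat.
have wK u : w (pickle u) = u by rewrite /w pickleK.
pose xs i := pt (w i); pose ns i := (size (w i) * k)%N.
apply: (@le_trans _ _ (\esum_(i in pickle @` G')
    cover_weight d T f (a + t) e xs ns i)%E).
  apply: ereal_inf_lbound; exists (pickle @` G'), xs, ns; split=> //; split.
    move=> _ [u [/GN Nu _] <-]; rewrite /ns wK.
    by rewrite (leq_trans Nu)// leq_pmulr.
  move=> x /GE[b Gb]; set u := mkseq _ _ in Gb.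
  have ux : cylinder u x by rewrite /cylinder /= size_mkseq.
  exists (pickle u); first by exists u => //; split=> //; exists x.
  have ptu : cylinder u (pt u) by apply: ptP; exists x.
  by rewrite /ns /xs wK; exact: cylinder_Bn ptu ux.
rewrite (@reindex_esum _ _ _ G' _ pickle); last first.
  by apply: inj_bij => u v _ _ /(pcan_inj pickleK).
apply: (@le_trans _ _ (\esum_(u in G') word_weight a u)%E); last first.
  by apply: esum_subset => [u|u []//]; exact: word_weight_ge0.
apply: le_esum => u [Gu u0]; rewrite lee_expeR /ns /xs wK.
apply: (le_trans (leeD2l _ (sup_Bn_le T _ _ e_gt0 f_close))).
have lo : ((fsum T f (size u * k) (pt u))%:E <=
    ereal_sup [set (fsum T f (size u * k) y)%:E | y in cylinder u])%E.
  by apply: ereal_sup_ubound; exists (pt u) => //; exact: ptP.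
by apply: le_trans (leeD2l _ lo); rewrite -!EFinD lee_fin; lra.
Qed.

Variables (L : nat) (eta : R) (lam : nat -> X -> nat).
Hypothesis eta_gt0 : 0 < eta.
Hypothesis lab_lam : forall x y, Bn d T k x eta y ->
  exists2 l, (l < L)%N & lab y = lam l x.

(** One of [L] labels per block, read along the orbit of the centre: a Bowen ball of radius [eta]
    and length [b * k] meets at most [L ^ b] cylinders of [b] letters. *)
Definition candidate_word (b : nat) (x : X) (c : {ffun 'I_b -> 'I_L}) : seq nat :=
  [seq lam (c j) (iter (j * k) T x) | j <- enum 'I_b].

Lemma word_candidate b x y : Bn d T (b * k) x eta y ->
  exists c : {ffun 'I_b -> 'I_L}, mkseq (block_name y) b = candidate_word x c.
Proof.
move=> /(dn_ltP _ _ _ _ _ eta_gt0) xy.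
have /choice[c cP] : forall j : 'I_b, exists l : 'I_L,
    block_name y j = lam l (iter (j * k) T x).
  move=> j; have [|l lL yl] := @lab_lam (iter (j * k) T x) (iter (j * k) T y).
    apply/(dn_ltP _ _ _ _ _ eta_gt0) => i ik; rewrite -!iterD; apply: xy.
    by rewrite (@leq_trans (j.+1 * k))// ?leq_mul2r ?ltn_ord ?orbT// mulSn ltn_add2r.
  by exists (Ordinal lL).
exists [ffun j => c j]; rewrite /mkseq -val_enum_ord -map_comp.
by apply: eq_map => j /=; rewrite ffunE -cP.
Qed.

Variables (a s h B : R).
Hypothesis f_bound : forall x, `|f x| <= B.
Hypothesis L_le : L%:R <= expR (k%:R * h).
Hypothesis shta : s + h + t <= a.

Lemma word_weight_le (n : nat) (x y : X) (e' : R) : Bn d T n x e' y ->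
  (word_weight a (mkseq (block_name y) (n %/ k)) <=
   (expR (- ((n %/ k * k)%:R * h)))%:E * ((expR (k%:R * (B + `|s|)))%:E *
   expeR ((- s * n%:R)%:E + ereal_sup [set (fsum T f n z)%:E | z in Bn d T n x e']))
  )%E.
Proof.
move=> xy; rewrite /word_weight size_mkseq.
rewrite -[(expR (- _))%:E]/(expeR (- _)%:E) -[(expR (k%:R * _))%:E]/(expeR (_ * _)%:E).
rewrite -!expeRD lee_expeR.
set b := (n %/ k)%N; set u := mkseq _ _.
have uy : cylinder u y by rewrite /cylinder /= size_mkseq.
have up : (ereal_sup [set (fsum T f (b * k) z)%:E | z in cylinder u] <=
    (fsum T f (b * k) y + (b * k)%:R * t)%:E)%E.
  apply: ge_ereal_sup => _ [z uz <-]; rewrite lee_fin.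
  apply: (fsum_close e_gt0 f_close).
  by have := cylinder_Bn uy uz; rewrite size_mkseq.
have lo : ((fsum T f n y)%:E <=
    ereal_sup [set (fsum T f n z)%:E | z in Bn d T n x e'])%E.
  by apply: ereal_sup_ubound; exists y.
apply: (le_trans (leeD2l _ up)).
apply: le_trans (leeD2l _ (leeD2l _ (leeD2l _ lo))); rewrite -!EFinD lee_fin.
have nE : n = (b * k + n %% k)%N by exact: divn_eq.
have B0 : 0 <= B by apply: le_trans (f_bound x).
have := fsum_truncate (b * k) (n %% k) y f_bound; rewrite -nE => trunc.
have rk : (n %% k)%:R <= k%:R :> R by rewrite ler_nat ltnW// ltn_mod.
have nR : n%:R = (b * k)%:R + (n %% k)%:R :> R by rewrite -natrD -nE.
have rB : (n %% k)%:R * B <= k%:R * B by rewrite ler_wpM2r.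
have rs : (n %% k)%:R * s <= k%:R * `|s|.
  by apply: (le_trans (ler_wpM2l _ (ler_norm s))) => //; rewrite ler_wpM2r.
have : (b * k)%:R * (s + h + t) <= (b * k)%:R * a by rewrite ler_wpM2l.
rewrite nR; lra.
Qed.

(** Each Bowen ball is replaced by the cylinders of [n %/ k] letters that it meets; their number, at
    most [L ^ (n %/ k)], is cancelled by the decay of rate [h]. *)
Lemma net_content_le (N : nat) (E : set X) (e' : R) I xs ns :
  0 < e' -> e' <= eta -> bowen_cover d T E (N * k) e' I xs ns ->
  (net_content block_name (word_weight a) N E <= (expR (k%:R * (B + `|s|)))%:E *
     \esum_(i in I) cover_weight d T f s e' xs ns i)%E.
Proof.
move=> e'0 e'eta [nsN cov].
pose G i := [set mkseq (block_name y) (ns i %/ k) | y in Bn d T (ns i) (xs i) e'].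
apply: (@le_trans _ _ (\esum_(u in \bigcup_(i in I) G i) word_weight a u)%E).
  apply: ereal_inf_lbound; exists (\bigcup_(i in I) G i) => //; split.
    by move=> _ [i Ii [y _ <-]]; rewrite size_mkseq leq_divRL//; exact: nsN.
  by move=> x /cov[i Ii xi]; exists (ns i %/ k)%N, i => //; exists x.
apply: le_trans (esum_mull_le I (expR_ge0 _) (fun i => expeR_ge0 _)).
apply: (le_trans (esum_bigcup_le I G (word_weight_ge0 a))).
apply: le_esum => i _; set n := ns i; set x := xs i; set b := (n %/ k)%N.
set V := (_ * cover_weight _ _ _ _ _ _ _ _)%E.
have V0 : (0 <= V)%E by rewrite mule_ge0 ?lee_fin ?expR_ge0// expeR_ge0.
set q := (expR (- ((b * k)%:R * h)))%:E.
have qV0 : (0 <= q * V)%E by rewrite mule_ge0 ?lee_fin ?expR_ge0.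
apply: (@le_trans _ _ (\esum_(u in G i) (q * V))%E).
  by apply: le_esum => _ [y xy <-]; exact: word_weight_le.
apply: (@le_trans _ _ (\esum_(u in (@candidate_word b x) @` setT) (q * V))%E).
  apply: esum_subset => // _ [y xy <-].
  have [|c cE] := @word_candidate b x y; last by exists c.
  by apply: (Bn_subset _ e'0 e'eta xy); rewrite leq_trunc_div.
apply: (le_trans (esum_image_le _ _ _)) => //.
rewrite esum_finType_const// card_ffun !card_ord muleA -[leRHS]mul1e.
apply: lee_wpmul2r => //; rewrite -EFinM lee_fin expRN ler_pdivrMr ?expR_gt0// mul1r.
rewrite natrM -mulrA expRM_natl natrX.
by apply: lerXn2r => //; rewrite nnegrE ?expR_ge0.
Qed.

End BlockNames.

(** * Choice of the block length and inner approximation by compact sets *)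

Lemma linear_le_expR (R : realType) (p : nat) (h : R) : 0 < h ->
  exists2 k, (0 < k)%N & (p * k).+1%:R <= expR (k%:R * h).
Proof.
(* Squaring [1 + x <= expR x] at [x = k * h / 2] gives the term [k^2 * h^2 / 4], which is at least
   [p * k] once [k >= q]. *)
move=> h0; pose q := 4 * p%:R / h ^+ 2.
have q0 : 0 <= q by apply: divr_ge0; [exact: mulr_ge0|exact: sqr_ge0].
have kq := archi_boundP q0; set k := Num.bound q in kq.
exists k; first by rewrite -(ltr_nat R); exact: le_lt_trans kq.
have h1 : 4 * p%:R <= k%:R * h ^+ 2.
  by rewrite -ler_pdivrMr ?exprn_gt0//; exact: ltW.
have -> : k%:R * h = k%:R * h / 2 + k%:R * h / 2 by lra.
rewrite expRD -natr1 natrM.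
have k0 : 0 <= k%:R :> R by [].
have kh0 : 0 <= k%:R * h by rewrite mulr_ge0// ltW.
have e1 := expR_ge1Dx (k%:R * h / 2).
have : (1 + k%:R * h / 2) * (1 + k%:R * h / 2) <=
       expR (k%:R * h / 2) * expR (k%:R * h / 2).
  by apply: ler_pM => //; lra.
have : k%:R * (4 * p%:R) <= k%:R * (k%:R * h ^+ 2) by rewrite ler_wpM2l.
by rewrite expr2; lra.
Qed.

Lemma compact_subset_PB (R : realType) (X : Type) (d : X -> X -> R) (T : X -> X)
    (f : X -> R) (Z : set X) (s : R) :
  is_metric d -> d_compact d setT -> d_continuous_self d T ->
  d_continuous_real d f -> analytic d Z -> (s%:E < PB d T f Z)%E ->
  exists K, [/\ K `<=` Z, d_compact d K & (s%:E <= PB d T f K)%E].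
Proof.
move=> dm Xc Tc fc [g [gcont gZ]] /ereal_between[s1 [ss1 s1Z]].
rewrite lte_fin in ss1.
have PBcvg := @PB_eps_cvg R X d T f dm Xc fc.
(* The gap is spent exactly: [s + h + t = a] for passing from Bowen balls to cylinders, and
   [a + t = s1] for the way back. *)
pose t := (s1 - s) / 4; pose h := (s1 - s) / 2; pose a := s1 - t.
have t0 : 0 < t by rewrite /t; lra.
have [e1 e10 ft1] := unif_cont dm Xc fc t0.
have [e [e0 ee1 s1e]] : exists e, [/\ 0 < e, e < e1 & (s1%:E < PB_eps d T f Z e)%E].
  apply: contrapT => /forallNP ne; move: s1Z; rewrite ltNge => /negP; apply.
  apply: (lime_le (PBcvg Z)); near=> e.
  by rewrite leNgt; apply/negP => ?; apply: (ne e).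
have ft x y : d x y < e -> `|f x - f y| < t.
  by move=> xy; apply: ft1; apply: lt_trans ee1.
have [N MB0] := PB_eps_gt s1e.
have [c [c0 cM]] := ereal_between MB0; rewrite lte_fin in c0.
have [p pP] := block_label dm Xc T e0.
have [k k0 kh] := linear_le_expR p (h := h) ltac:(by rewrite /h; lra).
have [eta [lab [lam [eta0 lab_Bn lab_lam]]]] := pP k.
have [B fB] := cont_bounded dm Xc fc.
pose C E := net_content (block_name T k lab) (word_weight T f k lab a) N E.
(* Small means content at most [c], a positive real below [MB] of [Z] at exponent [s1]; hence [Z] is
   not small. *)
have [||b bP] := @capacitability X g (fun E => (C E <= c%:E)%E).
- by move=> E; apply: net_content_incr; exact: word_weight_ge0.
- apply/negP; rewrite -ltNge gZ; apply: (lt_le_trans cM).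
  have -> : s1 = a + t by rewrite /a; lra.
  exact: (MB_le_net_content k0 e0 ft lab_Bn (g (fun=> 0%N))).
pose K := g @` [set x | forall i, (x i <= b i)%N].
have KZ : K `<=` Z by move=> _ [x _ <-]; rewrite -gZ; exists x.
exists K; split; first exact: KZ.
  move=> F Fopen FK; have [u [l [uF ul]]] := box_cover gcont Fopen FK.
  exists u; split=> // _ [x xb <-]; apply: ul; exists x => // i _; exact: xb.
pose D := expR (k%:R * (B + `|s|)).
have D0 : 0 < D by exact: expR_gt0.
apply: (lime_ge (PBcvg K)); near=> r.
have r0 : 0 < r by [].
have reta : r <= eta by near: r; exact: nbhs_right_ltW.
apply: (@PB_eps_ge _ _ _ _ _ _ _ (N * k)); apply: (@lt_le_trans _ _ (c / D)%:E).
  by rewrite lte_fin divr_gt0.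
apply: le_ereal_inf_tmp => _ [I [xs [ns [[nsN cov] ->]]]].
(* The balls are open, so a cover of [K] also covers the image of a truncated box, whose content
   exceeds [c]. This bounds the weight below by [c / D], whatever the cover and [r]. *)
pose F := [set Bn d T (ns i) (xs i) r | i in I].
have [U [i Ii <-]||u [l [uF ul]]] := @box_cover R X d g b F gcont.
- exact: Bn_open.
- by move=> x /cov[i Ii xi]; exists (Bn d T (ns i) (xs i) r) => //; exists i.
have cov' : bowen_cover d T (g @` below b l) (N * k) r I xs ns.
  by split=> // x /ul[V /uF[i Ii <-] xi]; exists i.
have /negP := bP l; rewrite -ltNge => cC.
rewrite mulrC EFinM lee_pdivrMl//; apply: ltW; apply: (lt_le_trans cC).
apply: (net_content_le k0 e0 ft lab_Bn eta0 lab_lam fB kh _ r0 reta cov').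
by rewrite /a /h /t; lra.
Unshelve. all: by end_near. Qed.

Theorem theoremA (R : realType) (X : Type) (d : X -> X -> R) (T : X -> X)
    (f : X -> R) (Z : set X) :
  is_metric d ->
  d_compact d setT ->
  d_continuous_self d T ->
  (htop d T < +oo)%E ->
  d_continuous_real d f ->
  analytic d Z ->
  PB d T f Z = ereal_sup [set PB d T f K | K in [set K : set X | K `<=` Z /\ d_compact d K]].
Proof.
move=> dm Xc Tc _ fc Zan; apply/eqP; rewrite eq_le; apply/andP; split; last first.
  by apply: ge_ereal_sup => _ [K [KZ _] <-]; exact: PB_mono.
rewrite leNgt; apply/negP => /ereal_between[s [lt_s s_lt]].
have [K [KZ Kc sK]] := compact_subset_PB dm Xc Tc fc Zan s_lt.
have : (PB d T f K <= ereal_sup [set PB d T f K |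
    K in [set K : set X | K `<=` Z /\ d_compact d K]])%E.
  by apply: ereal_sup_ubound; exists K.
by move=> /(le_trans sK); rewrite leNgt lt_s.
Qed.
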